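(* Let $H$ be a finite-dimensional Hopf algebra over a field $\Bbbk$, let $\mu\in H^*$ be the distinguished grouplike element of $H^*$, and let $(A,\rho_A)$ be a right $H$-comodule algebra. The cowreath $(A\otimes H^{\mathrm{op}},H,\psi)$ is Frobenius if and only if there is an invertible element $\mathcal{A}\in A$ such that $$a\mathcal{A}=\mu(a_1)\mathcal{A}a_0\quad\text{for every }a\in A.$$ Equivalently, $(A\otimes H^{\mathrm{op}},H,\psi)$ is Frobenius if and only if the morphism $(\mathrm{Id}_A\otimes\mu)\rho_A:A\to A$, $a\mapsto \mu(a_1)a_0$, is inner (i.e. is conjugation by an invertible element of $A$).
   Context: Everything is over a field $\Bbbk$, $\otimes=\otimes_{\Bbbk}$, and Sweedler notation with suppressed summation is used. $H$ is a Hopf algebra with counit $\varepsilon$ and antipode $S$; $H^{\mathrm{op}}$ is $H$ with opposite multiplication. A right $H$-comodule algebra $(A,\rho_A)$ is a unital associative algebra $A$ which is a right $H$-comodule via an algebra map $\rho_A:A\to A\otimes H$, $\rho_A(a)=a_0\otimes a_1$ (iterated: $a_0\otimes a_1\otimes a_2$, etc.). With $\psi:H\otimes A\otimes H^{\mathrm{op}}\to A\otimes H^{\mathrm{op}}\otimes H$, $\psi(h\otimes a\otimes l)=a_0\otimes l_1\otimes l_2ha_1$, one has a cowreath $(A\otimes H^{\mathrm{op}},H,\psi)$. The distinguished grouplike element of $H^*$ is the algebra map $\mu:H\to\Bbbk$ determined by $\Lambda h=\mu(h)\Lambda$ for all $h\in H$, where $\Lambda$ is a nonzero left integral in $H$ (i.e.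 $h\Lambda=\varepsilon(h)\Lambda$ for all $h$). Convention: whenever a multiplication symbol is omitted, products in $A\otimes H$ are computed with the ordinary multiplications of $A$ and of $H$ (not the opposite one). A Casimir morphism for $(H,\psi)$ is a $\Bbbk$-linear map $B:H\otimes H\to A\otimes H^{\mathrm{op}}$, written $B(h\otimes h')=B^A(h\otimes h')\otimes B^H(h\otimes h')$, such that for all $a\in A$, $g,h,h'\in H$: $$(a_0\otimes 1_H)B(g_2ha_1\otimes g_3h'a_2)(1_A\otimes g_1)=(1_A\otimes g)B(h\otimes h')(a\otimes 1_H),$$ $$B^A(h_2\otimes h')_0\otimes B^H(h_2\otimes h')_1\otimes B^H(h_2\otimes h')_2h_1B^A(h_2\otimes h')_1=B(h\otimes h'_1)\otimes h'_2.$$ The cowreath is Frobenius if there are a Casimir morphism $B$ and an element $\mathfrak{t}=\mathfrak{t}^1\otimes\mathfrak{t}^2\otimes\mathfrak{t}^3\in A\otimes H\otimes H$ such that for all $a\in A$, $h\in H$: $$a\mathfrak{t}^1\otimes\mathfrak{t}^2h\otimes\mathfrak{t}^3=\mathfrak{t}^1a_0\otimes h_1\mathfrak{t}^2\otimes h_2\mathfrak{t}^3a_1,$$ $$(\mathfrak{t}^1\otimes 1_H)B(\mathfrak{t}^3\otimes h)(1_A\otimes\mathfrak{t}^2)=\varepsilon(h)1_A\otimes 1_H=(\mathfrak{t}^1_0\otimes 1_H)B(\mathfrak{t}^2_2h\mathfrak{t}^1_1\otimes\mathfrak{t}^3)(1_A\otimes\mathfrak{t}^2_1).$$ *)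

(* Defs.v *)
From HB Require Import structures.
From mathcomp Require Import all_boot all_order all_algebra all_field.
From mathcomp Require Import boolp.

Set Implicit Arguments.
Unset Strict Implicit.
Unset Printing Implicit Defensive.

Import GRing.Theory.
Local Open Scope ring_scope.
Local Open Scope quotient_scope.

Reserved Notation "V \ox W" (at level 40, left associativity).
Reserved Notation "v \ot w" (at level 40, left associativity).
Reserved Notation "\sw_ ( x , y <- t ) E"
  (at level 34, x name, y name, t at level 10, E at level 34,
   format "\sw_ ( x ,  y  <-  t )  E").

(* The tensor product of two vector spaces: formal sums of pairs, modulo the
   identification of those that no bilinear map distinguishes.  Its universal
   property is given by [tensE], [tens_sum] and [lift_tens] below. *)
Section Tensor.
Variables (k : fieldType) (V W : lmodType k).

Definition tens_eval (U : lmodType k) (f : V -> W -> U) (s : seq (V * W)) : U :=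
  \sum_(p <- s) f p.1 p.2.

Definition tens_equiv (s t : seq (V * W)) : bool :=
  `[< forall (U : lmodType k) (f : {bilinear V -> W -> U}),
        tens_eval f s = tens_eval f t >].

Lemma tens_equiv_is_equiv : equiv_class_of tens_equiv.
Proof.
split=> [s|s t|t s u].
- exact/asboolP.
- by apply/asboolP/asboolP => st U f; rewrite st.
- by move=> /asboolP st /asboolP tu; apply/asboolP => U f; rewrite st.
Qed.

Canonical tens_equiv_rel := EquivRelPack tens_equiv_is_equiv.

Definition tensor : Type := {eq_quot tens_equiv}.

HB.instance Definition _ := Choice.copy tensor {eq_quot tens_equiv}.

Definition tens_pi (s : seq (V * W)) : tensor := \pi_{eq_quot tens_equiv} s.
Definition tens_repr (t : tensor) : seq (V * W) :=
  repr (t : {eq_quot tens_equiv}).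

Lemma tens_reprK : cancel tens_repr tens_pi.
Proof. exact: reprK. Qed.

Lemma tens_piP s t : reflect (tens_pi s = tens_pi t) (tens_equiv s t).
Proof. exact: eqquotP. Qed.

(* Sweedler-style summation of [f v w] over a representative of [t].  It is
   meaningful only for a bilinear [f], since only then is it independent of
   the representative ([tsumE] below). *)
Definition tsum (U : lmodType k) (f : V -> W -> U) (t : tensor) : U :=
  tens_eval f (tens_repr t).

Definition tens (v : V) (w : W) : tensor := tens_pi [:: (v, w)].

Lemma tsum_pi (U : lmodType k) (f : {bilinear V -> W -> U}) s :
  tsum f (tens_pi s) = tens_eval f s.
Proof.
have /tens_piP/asboolP e := tens_reprK (tens_pi s); exact: e.
Qed.

Lemma tensor_ext (x y : tensor) :
  (forall (U : lmodType k) (f : {bilinear V -> W -> U}), tsum f x = tsum f y) ->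
  x = y.
Proof. by move=> xy; rewrite -[x]tens_reprK -[y]tens_reprK; apply/tens_piP/asboolP. Qed.

Definition tens_zero : tensor := tens_pi [::].
Definition tens_add (x y : tensor) : tensor := tens_pi (tens_repr x ++ tens_repr y).
Definition tens_scale (a : k) (x : tensor) : tensor :=
  tens_pi [seq (a *: p.1, p.2) | p <- tens_repr x].

Section Bil.
Variables (U : lmodType k) (f : {bilinear V -> W -> U}).

Lemma tsum_zero : tsum f tens_zero = 0.
Proof. by rewrite tsum_pi /tens_eval big_nil. Qed.

Lemma tsum_add x y : tsum f (tens_add x y) = tsum f x + tsum f y.
Proof. by rewrite tsum_pi /tens_eval big_cat. Qed.

Lemma tsum_scale a x : tsum f (tens_scale a x) = a *: tsum f x.
Proof.
rewrite tsum_pi /tens_eval big_map scaler_sumr.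
by apply: eq_bigr => p _; rewrite linearZl_LR.
Qed.
End Bil.

Let tens_opp x := tens_scale (-1) x.

Fact tens_addA : associative tens_add.
Proof. by move=> x y z; apply: tensor_ext => U f; rewrite !tsum_add addrA. Qed.
Fact tens_addC : commutative tens_add.
Proof. by move=> x y; apply: tensor_ext => U f; rewrite !tsum_add addrC. Qed.
Fact tens_add0 : left_id tens_zero tens_add.
Proof.
by move=> x; apply: tensor_ext => U f; rewrite tsum_add tsum_zero add0r.
Qed.
Fact tens_addN : left_inverse tens_zero tens_opp tens_add.
Proof.
move=> x; apply: tensor_ext => U f.
by rewrite tsum_add tsum_scale tsum_zero scaleN1r addNr.
Qed.

HB.instance Definition _ :=
  GRing.isZmodule.Build tensor tens_addA tens_addC tens_add0 tens_addN.

Fact tens_scaleA a b x : tens_scale a (tens_scale b x) = tens_scale (a * b) x.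
Proof. by apply: tensor_ext => U f; rewrite !tsum_scale scalerA. Qed.
Fact tens_scale1 : left_id 1 tens_scale.
Proof. by move=> x; apply: tensor_ext => U f; rewrite tsum_scale scale1r. Qed.
Fact tens_scaleDr : right_distributive tens_scale +%R.
Proof.
move=> a x y; apply: tensor_ext => U f.
by rewrite !(tsum_scale, tsum_add) scalerDr.
Qed.
Fact tens_scaleDl x : {morph tens_scale^~ x : a b / a + b}.
Proof.
move=> a b; apply: tensor_ext => U f.
by rewrite !(tsum_scale, tsum_add) scalerDl.
Qed.

HB.instance Definition _ := GRing.Zmodule_isLmodule.Build k tensor
  tens_scaleA tens_scale1 tens_scaleDr tens_scaleDl.

Fact tens_bilinear : bilinear_for *:%R *:%R tens.
Proof.
by split=> x a u v; apply: tensor_ext => U f;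
  rewrite tsum_add tsum_scale !tsum_pi /tens_eval !big_seq1 /=
          (linearPl, linearPr).
Qed.
HB.instance Definition _ :=
  bilinear_isBilinear.Build k V W tensor *:%R *:%R tens tens_bilinear.

Fact tsum_linear (U : lmodType k) (f : {bilinear V -> W -> U}) :
  linear (tsum f).
Proof. by move=> a x y; rewrite tsum_add tsum_scale. Qed.
Definition lift_tens (U : lmodType k) (f : {bilinear V -> W -> U}) := tsum f.
HB.instance Definition _ (U : lmodType k) (f : {bilinear V -> W -> U}) :=
  GRing.isLinear.Build k tensor U *:%R (lift_tens f) (tsum_linear f).

Lemma tensE (U : lmodType k) (f : {bilinear V -> W -> U}) v w :
  tsum f (tens v w) = f v w.
Proof. by rewrite tsum_pi /tens_eval big_seq1. Qed.

Lemma tsum_sum (U : lmodType k) (f : {bilinear V -> W -> U}) I (r : seq I)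
    (F : I -> tensor) :
  tsum f (\sum_(i <- r) F i) = \sum_(i <- r) tsum f (F i).
Proof. exact: (linear_sum (lift_tens f)). Qed.

Lemma tens_sum (t : tensor) : t = \sum_(p <- tens_repr t) tens p.1 p.2.
Proof.
apply: tensor_ext => U f.
rewrite tsum_sum.
by rewrite [LHS]/tsum /tens_eval; apply: eq_bigr => p _; rewrite tensE.
Qed.

Lemma tsumE (U : lmodType k) (f : {bilinear V -> W -> U}) s :
  tsum f (\sum_(p <- s) tens p.1 p.2) = \sum_(p <- s) f p.1 p.2.
Proof.
rewrite tsum_sum.
by apply: eq_bigr => p _; rewrite tensE.
Qed.

Lemma tensor_ind_tens (P : tensor -> Prop) :
  P 0 -> (forall x y, P x -> P y -> P (x + y)) -> (forall v w, P (tens v w)) ->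
  forall t, P t.
Proof. by move=> P0 PD Pt t; rewrite (tens_sum t); elim/big_ind: _. Qed.

End Tensor.

Notation "V \ox W" := (tensor V W) : type_scope.
Notation "v \ot w" := (tens v w) : ring_scope.
Notation "\sw_ ( x , y <- t ) E" := (tsum (fun x y => E) t) : ring_scope.

Section TsumTheory.
Variables (k : fieldType) (V W U : lmodType k).
Implicit Types f g : V -> W -> U.

Lemma tsum_linearr f : bilinear_for *:%R *:%R f -> linear (tsum f).
Proof.
move=> bf; pose F : {bilinear V -> W -> U} :=
  HB.pack f (bilinear_isBilinear.Build k V W U *:%R *:%R f bf).
exact: (tsum_linear F).
Qed.

Lemma tsum_tens f v w : bilinear_for *:%R *:%R f -> tsum f (v \ot w) = f v w.
Proof.
move=> bf; pose F : {bilinear V -> W -> U} :=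
  HB.pack f (bilinear_isBilinear.Build k V W U *:%R *:%R f bf).
exact: (tensE F).
Qed.

Lemma tsum_linearl a f g t :
  tsum (fun v w => a *: f v w + g v w) t = a *: tsum f t + tsum g t.
Proof. by rewrite /tsum /tens_eval scaler_sumr -big_split. Qed.

Lemma eq_tsum f g t : (forall v w, f v w = g v w) -> tsum f t = tsum g t.
Proof. by move=> fg; apply: eq_bigr => p _; rewrite fg. Qed.

End TsumTheory.

(* The algebra structure of [A \ox H].  The algebra [H] is finite-dimensional
   only because [algType] asks for [1 != 0], which is obtained here from a
   linear form on [H]. *)
Section TensorAlgebra.
Variables (k : fieldType) (A : algType k) (H : falgType k).
Implicit Types x y z : (A \ox H)%type.

Definition tens_mul x y : A \ox H :=
  \sw_(a, h <- x) \sw_(b, g <- y) ((a * b) \ot (h * g)).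

Definition tens_one : A \ox H := 1 \ot 1.

Fact tens_mul_bil2 a h :
  bilinear_for *:%R *:%R (fun (b : A) (g : H) => (a * b) \ot (h * g)).
Proof.
by split=> u c x y; rewrite mulrDr -scalerAr (linearPl, linearPr).
Qed.

Fact tens_mul_bil1 y : bilinear_for *:%R *:%R
  (fun (a : A) (h : H) => \sw_(b, g <- y) ((a * b) \ot (h * g))).
Proof.
split=> u c v w; rewrite -tsum_linearl; apply: eq_tsum => b g;
  by rewrite mulrDl -scalerAl (linearPl, linearPr).
Qed.

Fact tens_mul_linearl y : linear (tens_mul^~ y).
Proof. exact: tsum_linearr (tens_mul_bil1 y). Qed.

Fact tens_mul_linearr x : linear (tens_mul x).
Proof.
move=> c y z; rewrite /tens_mul -tsum_linearl; apply: eq_tsum => a h.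
exact: tsum_linearr (tens_mul_bil2 a h) c y z.
Qed.

Fact tens_mulE (a b : A) (h g : H) :
  tens_mul (a \ot h) (b \ot g) = (a * b) \ot (h * g).
Proof.
by rewrite /tens_mul (tsum_tens _ _ (tens_mul_bil1 _))
           (tsum_tens _ _ (tens_mul_bil2 _ _)).
Qed.

Fact tens_mulDl : left_distributive tens_mul +%R.
Proof.
by move=> x y z; have := tens_mul_linearl z 1 x y; rewrite !scale1r.
Qed.

Fact tens_mulDr : right_distributive tens_mul +%R.
Proof.
by move=> x y z; have := tens_mul_linearr x 1 y z; rewrite !scale1r.
Qed.

Fact tens_mul0l : left_zero 0 tens_mul.
Proof.
by move=> y; apply: (addrI (tens_mul 0 y)); rewrite -tens_mulDl !addr0.
Qed.

Fact tens_mul0r : right_zero 0 tens_mul.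
Proof.
by move=> x; apply: (addrI (tens_mul x 0)); rewrite -tens_mulDr !addr0.
Qed.

Fact tens_mulA : associative tens_mul.
Proof.
elim/tensor_ind_tens=> [y z|x x' IHx IHx' y z|a h]; first by rewrite !tens_mul0l.
  by rewrite !tens_mulDl IHx IHx'.
elim/tensor_ind_tens=> [z|y y' IHy IHy' z|b g].
- by rewrite tens_mul0r !tens_mul0l tens_mul0r.
- by rewrite tens_mulDr !tens_mulDl tens_mulDr IHy IHy'.
elim/tensor_ind_tens=> [|z z' IHz IHz'|c l]; first by rewrite !tens_mul0r.
  by rewrite !tens_mulDr IHz IHz'.
by rewrite !tens_mulE !mulrA.
Qed.

Fact tens_mul1l : left_id tens_one tens_mul.
Proof.
elim/tensor_ind_tens=> [|x y IHx IHy|a h]; first exact: tens_mul0r.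
  by rewrite tens_mulDr IHx IHy.
by rewrite tens_mulE !mul1r.
Qed.

Fact tens_mul1r : right_id tens_one tens_mul.
Proof.
elim/tensor_ind_tens=> [|x y IHx IHy|a h]; first exact: tens_mul0l.
  by rewrite tens_mulDl IHx IHy.
by rewrite tens_mulE !mulr1.
Qed.

Fact tens_one_neq0 : tens_one != 0.
Proof.
have [i ci] : exists i, coord (vbasis {:H}) i 1 != 0.
  apply/existsP; apply: contraT; rewrite negb_exists => /forallP c0.
  have /eqP[] := oner_neq0 H; rewrite (coord_vbasis (memvf (1 : H))).
  by apply: big1 => i _; move/negbNE/eqP: (c0 i) => ->; rewrite scale0r.
pose f (a : A) (h : H) : A := coord (vbasis {:H}) i h *: a.
have bf : bilinear_for *:%R *:%R f.
  split=> u c x y; rewrite /f /=; first by rewrite scalerDr !scalerA mulrC.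
  by rewrite linearD linearZ scalerDl -scalerA.
apply: contraNneq ci => e0.
have := tsum_tens 1 1 bf; rewrite -/tens_one e0.
have -> : tsum f 0 = 0.
  by have := tsum_linearr bf (-1) 0 0; rewrite !scaleN1r !addNr.
by move/esym/eqP; rewrite scaler_eq0 oner_eq0 orbF.
Qed.

HB.instance Definition _ := GRing.Zmodule_isNzRing.Build (A \ox H)%type
  tens_mulA tens_mul1l tens_mul1r tens_mulDl tens_mulDr tens_one_neq0.

Fact tens_scaleAl c x y : c *: (x * y) = (c *: x) * y.
Proof.
have := tens_mul_linearl y c x 0; rewrite addr0 tens_mul0l addr0.
by move/esym.
Qed.

Fact tens_scaleAr c x y : c *: (x * y) = x * (c *: y).
Proof.
have := tens_mul_linearr x c y 0; rewrite addr0 tens_mul0r addr0.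
by move/esym.
Qed.

HB.instance Definition _ :=
  GRing.Lmodule_isLalgebra.Build k (A \ox H)%type tens_scaleAl.
HB.instance Definition _ :=
  GRing.Lalgebra_isAlgebra.Build k (A \ox H)%type tens_scaleAr.

Lemma tensM (a b : A) (h g : H) :
  (a \ot h) * (b \ot g) = (a * b) \ot (h * g).
Proof. exact: tens_mulE. Qed.

End TensorAlgebra.

(* A Hopf algebra structure on a finite-dimensional algebra. *)
Record hopf (k : fieldType) (H : falgType k) := Hopf {
  comul : {lrmorphism H -> H \ox H};
  counit : {lrmorphism H -> k | *%R};
  antipode : {linear H -> H};
  (* both sides in (H \ox H) \ox H *)
  comulA : forall h,
    \sw_(h', h3 <- comul h) \sw_(h1, h2 <- comul h') (h1 \ot h2 \ot h3) =
    \sw_(h1, h' <- comul h) \sw_(h2, h3 <- comul h') (h1 \ot h2 \ot h3);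
  comul1l : forall h, \sw_(h1, h2 <- comul h) (counit h1 *: h2) = h;
  comul1r : forall h, \sw_(h1, h2 <- comul h) (counit h2 *: h1) = h;
  antipodel : forall h,
    \sw_(h1, h2 <- comul h) (antipode h1 * h2) = counit h *: 1;
  antipoder : forall h,
    \sw_(h1, h2 <- comul h) (h1 * antipode h2) = counit h *: 1
}.

Record comodule_algebra (k : fieldType) (H : falgType k) (HH : hopf H)
    (A : algType k) := ComoduleAlgebra {
  coact :> {lrmorphism A -> A \ox H};
  coactA : forall a,
    \sw_(a', a2 <- coact a) \sw_(a0, a1 <- coact a') (a0 \ot a1 \ot a2) =
    \sw_(a0, h <- coact a) \sw_(a1, a2 <- comul HH h) (a0 \ot a1 \ot a2);
  coact1 : forall a, \sw_(a0, a1 <- coact a) (counit HH a1 *: a0) = a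
}.

Definition left_integral (k : fieldType) (H : falgType k) (HH : hopf H)
    (L : H) : Prop :=
  forall h, h * L = counit HH h *: L.

Definition distinguished_grouplike (k : fieldType) (H : falgType k)
    (HH : hopf H) (mu : {lrmorphism H -> k | *%R}) : Prop :=
  exists L : H,
    [/\ L != 0, left_integral HH L & forall h, L * h = mu h *: L].

Section Cowreath.
Variables (k : fieldType) (H : falgType k) (HH : hopf H).
Variables (A : algType k) (rho : comodule_algebra HH A).

Local Notation Delta := (comul HH).
Local Notation eps := (counit HH).

(* The map [psi] of the cowreath [(A (x) H^op, H, psi)]; the middle factor of
   the result and [l] are elements of [H^op], whose underlying space is [H],
   and all products are taken in [H]. *)
Definition cowreath_psi (h : H) (a : A) (l : H) : A \ox H \ox H :=
  \sw_(a0, a1 <- rho a) \sw_(l1, l2 <- Delta l) (a0 \ot l1 \ot (l2 * h * a1)).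

(* [B] takes its values in [A (x) H^op], which as a space is [A (x) H]; the
   products below are those of [A] and of [H], not of [H^op].  Threefold
   Sweedler indices are read off [(Delta (x) id) Delta] and
   [(rho (x) id) rho]. *)
Definition casimir (B : {linear H \ox H -> A \ox H}) : Prop :=
  (forall (a : A) (g h h' : H),
     \sw_(g', g3 <- Delta g) \sw_(g1, g2 <- Delta g')
       \sw_(a', a2 <- rho a) \sw_(a0, a1 <- rho a')
         ((a0 \ot 1) * B ((g2 * h * a1) \ot (g3 * h' * a2)) * (1 \ot g1))
     = (1 \ot g) * B (h \ot h') * (a \ot 1))
  /\ (forall h h' : H,
     \sw_(h1, h2 <- Delta h) \sw_(b, c <- B (h2 \ot h')) cowreath_psi h1 b c
     = \sw_(h'1, h'2 <- Delta h') (B (h \ot h'1) \ot h'2)).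

(* In the sums over [t], the factors of [t = t1 (x) t2 (x) t3] are reached
   through its decomposition in [(A (x) H) (x) H]. *)
Definition frobenius_element (t : A \ox H \ox H) : Prop :=
  forall (a : A) (h : H),
    \sw_(t', t3 <- t) \sw_(t1, t2 <- t') ((a * t1) \ot (t2 * h) \ot t3) =
    \sw_(t', t3 <- t) \sw_(t1, t2 <- t')
      \sw_(a0, a1 <- rho a) \sw_(h1, h2 <- Delta h)
        ((t1 * a0) \ot (h1 * t2) \ot (h2 * t3 * a1)).

Definition frobenius_counit (B : {linear H \ox H -> A \ox H})
    (t : A \ox H \ox H) : Prop :=
  forall h : H,
    \sw_(t', t3 <- t) \sw_(t1, t2 <- t')
      ((t1 \ot 1) * B (t3 \ot h) * (1 \ot t2)) = eps h *: (1 \ot 1)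
    /\
    eps h *: (1 \ot 1) =
    \sw_(t', t3 <- t) \sw_(t1, t2 <- t')
      \sw_(t10, t11 <- rho t1) \sw_(t21, t22 <- Delta t2)
        ((t10 \ot 1) * B ((t22 * h * t11) \ot t3) * (1 \ot t21)).

Definition frobenius_cowreath : Prop :=
  exists B : {linear H \ox H -> A \ox H}, exists t : A \ox H \ox H,
    [/\ casimir B, frobenius_element t & frobenius_counit B t].

End Cowreath.

(* The map [(Id_A (x) mu) rho]. *)
Definition coact_twist (k : fieldType) (H : falgType k) (HH : hopf H)
    (A : algType k) (rho : comodule_algebra HH A) (mu : H -> k) (a : A) : A :=
  \sw_(a0, a1 <- rho a) (mu a1 *: a0).

(* [A] carries no [unitRingType] structure, so [GRing.unit] is not available. *)
Definition invertible (k : fieldType) (A : algType k) (u : A) : Prop :=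
  exists v : A, u * v = 1 /\ v * u = 1.

Definition inner (k : fieldType) (A : algType k) (f : A -> A) : Prop :=
  exists u v : A, [/\ u * v = 1, v * u = 1 & forall a, f a = u * a * v].

(* Main.v *)
(* Write [sigma a = mu(a_1) a_0].  Let [L] be the left integral and [lam] the
   linear form with [lam(L_1) L_2 = 1]; both the bijectivity and the
   antimultiplicativity of [S] come from the nondegeneracy of the pairing
   [(x, y) |-> lam(S(x) y)].

   If [u] is invertible with inverse [v] and [a u = u sigma(a)], then
   [B(x (x) y) = lam(S(x v_1) y) v_0 (x) 1] and [t = u (x) 1 (x) L] form a
   Frobenius system.

   Conversely, for a Frobenius system [(B, t)] put
   [r = t^1 (x) S(t^2) t^3] in [A (x) H].  The condition on [t] becomes
   [(a (x) S(h)) r = eps(h) r rho(a)], so the second leg of [r] is a left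
   integral, [r = u (x) L], and [a u = u sigma(a)].  With [eps] applied to the
   second leg, the other counit condition reads [u_0 f(u_1 (x) L) = 1] for
   [f = (id (x) eps) B], and the Casimir condition turns this into
   [sigma(f(1 (x) L)) u = 1]. *)
From HB Require Import structures.
Require Import Defs.
From mathcomp Require Import all_boot all_order all_algebra all_field.
Import GRing.Theory.
Local Open Scope ring_scope.

Set Implicit Arguments.
Unset Strict Implicit.
Unset Printing Implicit Defensive.

(** * Linearity of Sweedler sums *)

Section SweedlerSums.
Context {k : fieldType} {V W X Y Z : lmodType k}.

Lemma bilinearI (f : V -> W -> X) :
  (forall w, linear (fun v => f v w)) -> (forall v, linear (f v)) ->
  bilinear_for *:%R *:%R f.
Proof. by []. Qed.

Lemma linear_fun0 (f : V -> W) : linear f -> f 0 = 0.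
Proof. by move=> lf; have := lf (-1) 0 0; rewrite !scaleN1r !addNr. Qed.

Lemma linear_funZ (f : V -> W) a v : linear f -> f (a *: v) = a *: f v.
Proof. by move=> lf; rewrite -[a *: v]addr0 lf (linear_fun0 lf) addr0. Qed.

Lemma tsum_map (L : {linear X -> Y}) (f : V -> W -> X) (t : V \ox W) :
  L (tsum f t) = \sw_(v, w <- t) L (f v w).
Proof. exact: linear_sum. Qed.

Lemma tsum_lmap (L : X -> Y) (f : V -> W -> X) (t : V \ox W) :
  linear L -> L (tsum f t) = \sw_(v, w <- t) L (f v w).
Proof.
move=> linL; pose M : {linear X -> Y} :=
  HB.pack L (GRing.isLinear.Build k X Y *:%R L linL).
exact: (tsum_map M).
Qed.

Lemma tsumZ (c : k) (f : V -> W -> X) (t : V \ox W) :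
  c *: tsum f t = \sw_(v, w <- t) (c *: f v w).
Proof. exact: scaler_sumr. Qed.

Lemma exchange_tsum {T U : lmodType k} (f : V -> W -> T -> U -> X) (s : V \ox W)
    (t : T \ox U) :
  \sw_(v, w <- s) \sw_(x, y <- t) f v w x y =
  \sw_(x, y <- t) \sw_(v, w <- s) f v w x y.
Proof. exact: exchange_big. Qed.

Lemma linear_id : linear (fun v : V => v).
Proof. by []. Qed.

Lemma linear_map (L : {linear W -> X}) (f : V -> W) :
  linear f -> linear (fun v => L (f v)).
Proof. by move=> lf a u v; rewrite lf linearP. Qed.

Lemma linear_comp_lin (L : W -> X) (f : V -> W) :
  linear L -> linear f -> linear (fun v => L (f v)).
Proof. by move=> lL lf a u v; rewrite lf lL. Qed.

Lemma linear_scale (c : k) (f : V -> W) :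
  linear f -> linear (fun v => c *: f v).
Proof. by move=> lf a u v; rewrite lf scalerDr !scalerA mulrC. Qed.

Lemma linear_form (chi : {linear X -> k | *%R}) (f : V -> X) (w : W) :
  linear f -> linear (fun v => chi (f v) *: w).
Proof. by move=> lf a u v; rewrite lf linearP scalerDl scalerA. Qed.

Lemma linear_tensl (f : V -> X) (w : W) :
  linear f -> linear (fun v => f v \ot w).
Proof. by move=> lf a u v; rewrite lf linearPl. Qed.

Lemma linear_tensr (f : V -> X) (w : W) :
  linear f -> linear (fun v => w \ot f v).
Proof. by move=> lf a u v; rewrite lf linearPr. Qed.

Lemma linear_tsum (f : Z -> V -> W -> X) (t : V \ox W) :
  (forall v w, linear (fun z => f z v w)) -> linear (fun z => tsum (f z) t).
Proof.
by move=> lf a u v; rewrite -tsum_linearl; apply: eq_tsum => x y; rewrite lf.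
Qed.

Lemma linear_tsum_arg (f : V -> W -> X) (g : Z -> V \ox W) :
  (forall w, linear (fun v => f v w)) -> (forall v, linear (f v)) ->
  linear g -> linear (fun z => tsum f (g z)).
Proof. by move=> fl fr lg a u v; rewrite lg tsum_linearr. Qed.

End SweedlerSums.

Lemma linear_mull {k : fieldType} {V : lmodType k} {R : algType k}
  (f : V -> R) (c : R) : linear f -> linear (fun v => f v * c).
Proof. by move=> lf a u v; rewrite lf mulrDl scalerAl. Qed.

Lemma linear_mulr {k : fieldType} {V : lmodType k} {R : algType k}
  (f : V -> R) (c : R) : linear f -> linear (fun v => c * f v).
Proof. by move=> lf a u v; rewrite lf mulrDr scalerAr. Qed.

(** Recursion on the body of the function. The recursive call sits inside each branch of [first], so
    a branch that gets stuck is abandoned for the next one. *)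
Ltac lin :=
  cbv beta;
  first
  [ assumption | match goal with H : forall _, _ |- _ => apply: H end
  | match goal with H : forall _, GRing.linear_for _ _ |- _ =>
      apply: (linear_comp_lin (H _)); lin end
  | match goal with H : forall _ _, GRing.linear_for _ _ |- _ =>
      apply: (linear_comp_lin (H _ _)); lin end
  | match goal with H : GRing.linear_for _ _ |- _ =>
      apply: (linear_comp_lin H); lin end
  | match goal with |- forall _, _ => intro; lin end
  | exact: linear_id
  | apply: linear_form; lin
  | apply: linear_scale; lin
  | apply: linear_tensl; lin
  | apply: linear_tensr; lin
  | apply: linear_tsum_arg; lin
  | apply: linear_tsum; lin
  | apply: linear_mull; lin
  | apply: linear_mulr; lin
  | apply: linear_map; lin ].

(** * Trilinear maps and threefold tensor products *)

Section Trilinear.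
Context {k : fieldType} {V W X Y : lmodType k}.

Definition trilinear (F : V -> W -> X -> Y) : Prop :=
  [/\ forall w x, linear (fun v => F v w x),
      forall v x, linear (fun w => F v w x) & forall v w, linear (F v w)].

(** The nesting is that of the sums over [t] in [frobenius_element] and [frobenius_counit], which
    therefore fold to [lift3] by conversion. *)
Definition lift3 (F : V -> W -> X -> Y) (t : V \ox W \ox X) : Y :=
  \sw_(s, x <- t) \sw_(v, w <- s) F v w x.

Variable F : V -> W -> X -> Y.
Hypothesis triF : trilinear F.

Lemma lift3_bilinear :
  bilinear_for *:%R *:%R (fun s x => \sw_(v, w <- s) F v w x).
Proof. case: triF => F1 F2 F3; apply: bilinearI; lin. Qed.

Lemma lift3_linear : linear (lift3 F).
Proof. exact: tsum_linearr lift3_bilinear. Qed.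

Lemma lift3_tens v w x : lift3 F (v \ot w \ot x) = F v w x.
Proof.
rewrite /lift3 (tsum_tens _ _ lift3_bilinear).
case: triF => F1 F2 F3; rewrite tsum_tens //; exact: bilinearI.
Qed.

End Trilinear.

Ltac trilin := split; lin.

(** * Hopf algebras and their integrals *)

Section HopfAlgebra.
Context {k : fieldType} {H : falgType k} {HH : hopf H}.
Local Notation Delta := (comul HH).
Local Notation eps := (counit HH).
Local Notation S := (antipode HH).

Section Sweedler.
Context {V : lmodType k}.

Lemma sw_coassoc (F : H -> H -> H -> V) h : trilinear F ->
  \sw_(h', h3 <- Delta h) \sw_(h1, h2 <- Delta h') F h1 h2 h3 =
  \sw_(h1, h' <- Delta h) \sw_(h2, h3 <- Delta h') F h1 h2 h3.
Proof.
move=> triF; have := congr1 (lift3 F) (comulA HH h).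
rewrite !(tsum_lmap _ _ (lift3_linear triF)).
under eq_tsum => x y do rewrite (tsum_lmap _ _ (lift3_linear triF)).
under [RHS]eq_tsum => x y do rewrite (tsum_lmap _ _ (lift3_linear triF)).
under eq_tsum => x y do under eq_tsum => z t do rewrite (lift3_tens triF).
under [RHS]eq_tsum => x y do under eq_tsum => z t do rewrite (lift3_tens triF).
by [].
Qed.

Lemma sw_counitl (f : H -> V) h : linear f ->
  \sw_(h1, h2 <- Delta h) (eps h1 *: f h2) = f h.
Proof.
move=> lf; rewrite -[in RHS](comul1l HH h) (tsum_lmap _ _ lf).
by apply: eq_tsum => x y; rewrite linear_funZ.
Qed.

Lemma sw_counitr (f : H -> V) h : linear f ->
  \sw_(h1, h2 <- Delta h) (eps h2 *: f h1) = f h.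
Proof.
move=> lf; rewrite -[in RHS](comul1r HH h) (tsum_lmap _ _ lf).
by apply: eq_tsum => x y; rewrite linear_funZ.
Qed.

Lemma sw_antipodel (f : H -> V) h : linear f ->
  \sw_(h1, h2 <- Delta h) f (S h1 * h2) = eps h *: f 1.
Proof. by move=> lf; rewrite -tsum_lmap // antipodel linear_funZ. Qed.

Lemma sw_antipoder (f : H -> V) h : linear f ->
  \sw_(h1, h2 <- Delta h) f (h1 * S h2) = eps h *: f 1.
Proof. by move=> lf; rewrite -tsum_lmap // antipoder linear_funZ. Qed.

Lemma sw_mul {A : algType k} (F : A -> H -> V) (s t : A \ox H) :
    bilinear_for *:%R *:%R F ->
  tsum F (s * t) = \sw_(a, h <- s) \sw_(b, g <- t) F (a * b) (h * g).
Proof.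
move=> bF; rewrite [s * t]/(tens_mul s t) /tens_mul.
rewrite (tsum_lmap _ _ (tsum_linearr bF)); apply: eq_tsum => a h.
rewrite (tsum_lmap _ _ (tsum_linearr bF)); apply: eq_tsum => b g.
exact: tsum_tens.
Qed.

Lemma sw_comulM (F : H -> H -> V) g h : bilinear_for *:%R *:%R F ->
  tsum F (Delta (g * h)) =
  \sw_(g1, g2 <- Delta g) \sw_(h1, h2 <- Delta h) F (g1 * h1) (g2 * h2).
Proof. by move=> bF; rewrite rmorphM sw_mul. Qed.

Lemma sw_comul1 (F : H -> H -> V) : bilinear_for *:%R *:%R F ->
  tsum F (Delta 1) = F 1 1.
Proof. by move=> bF; rewrite rmorph1 tsum_tens. Qed.

End Sweedler.

Lemma antipode1 : S 1 = 1.
Proof.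
have := antipodel HH 1; rewrite sw_comul1 ?mulr1 ?rmorph1 ?scale1r //.
by apply: bilinearI; lin.
Qed.

(** Apply [eps] to [S h1 * h2] and use its multiplicativity. *)
Lemma counit_antipode h : eps (S h) = eps h.
Proof.
transitivity (eps (\sw_(h1, h2 <- Delta h) (S h1 * h2))); last first.
  by rewrite antipodel linearZ rmorph1 /= mulr1.
rewrite -{1}(comul1r HH h) /tsum /tens_eval !linear_sum.
by apply: eq_bigr => p _; rewrite /= !linearZ rmorphM mulrC.
Qed.

Section LeftIntegral.
Context (L : H) (intL : left_integral HH L).

(** Consider the legs [S h1 * h2 * L1] and [h3 * L2]. Collapsing
    [Delta h' * Delta L = Delta (h' * L)] to [eps h' *: Delta L] gives the left side, collapsing
    [S h1 * h2] the right side. *)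
Lemma sw_integral_shift {V : lmodType k} (F : H -> H -> V) h :
    bilinear_for *:%R *:%R F ->
  \sw_(x, y <- Delta L) F (S h * x) y = \sw_(x, y <- Delta L) F x (h * y).
Proof.
move=> bF; have [Fl Fr] := bF.
pose G h1 h2 h3 := \sw_(x, y <- Delta L) F (S h1 * (h2 * x)) (h3 * y).
have triG : trilinear G by rewrite /G; trilin.
transitivity (\sw_(h1, h' <- Delta h) \sw_(h2, h3 <- Delta h') G h1 h2 h3).
  rewrite -(sw_counitr (f := fun h => \sw_(x, y <- Delta L) F (S h * x) y));
    last by lin.
  apply: eq_tsum => h1 h'; rewrite /G.
  rewrite -(sw_comulM (F := fun x y => F (S h1 * x) y));
    last by apply: bilinearI; lin.
  rewrite intL linearZ.
  by rewrite linear_funZ //; apply: tsum_linearr; apply: bilinearI; lin.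
rewrite -sw_coassoc // /G.
rewrite -[RHS](sw_counitl (f := fun h => \sw_(x, y <- Delta L) F x (h * y)));
  last by lin.
apply: eq_tsum => h' h3.
under eq_tsum => h1 h2 do under eq_tsum => x y do rewrite mulrA.
rewrite (sw_antipodel (f := fun z => \sw_(x, y <- Delta L) F (z * x) (h3 * y)));
  last by lin.
by under eq_tsum => x y do rewrite mul1r.
Qed.
End LeftIntegral.
End HopfAlgebra.

(* The two conditions say that the matrix of [b] is a left, respectively a
   right, inverse of the matrix of [t]. *)
Lemma dual_tensor_sym {k : fieldType} {V : vectType k} (b : V -> V -> k)
    (t : V \ox V) :
    (forall v, linear_for *%R (b v)) -> (forall v, linear_for *%R (b^~ v)) ->
    (forall v, \sw_(x, y <- t) (b v x *: y) = v) ->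
  forall v, \sw_(x, y <- t) (b y v *: x) = v.
Proof.
move=> br bl tK; pose e := vbasis {:V}; pose n := \dim {:V}.
have suml (v w : V) : b v w = \sum_(i < n) coord e i v * b e`_i w.
  pose B : {linear V -> k | *%R} :=
    HB.pack (b^~ w) (GRing.isLinear.Build k V k *%R (b^~ w) (bl w)).
  rewrite {1}(coord_vbasis (memvf v)) -[LHS]/(B _) linear_sum.
  by apply: eq_bigr => i _; rewrite linearZ.
have sumr (v w : V) : b v w = \sum_(i < n) coord e i w * b v e`_i.
  pose B : {linear V -> k | *%R} :=
    HB.pack (b v) (GRing.isLinear.Build k V k *%R (b v) (br v)).
  rewrite {1}(coord_vbasis (memvf w)) -[LHS]/(B _) linear_sum.
  by apply: eq_bigr => i _; rewrite linearZ.
have e_free (i j : 'I_n) : coord e j e`_i = (i == j)%:R :> k.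
  by rewrite coord_free ?(basis_free (vbasisP _)).
pose M := \matrix_(i < n, j < n)
  \sum_(p <- tens_repr t) coord e i p.1 * coord e j p.2.
pose N := \matrix_(i < n, j < n) b e`_i e`_j.
have NM : N *m M = 1%:M.
  apply/matrixP => i j; rewrite !mxE -e_free -[in RHS](tK e`_i) linear_sum.
  under eq_bigr => l _ do rewrite !mxE mulr_sumr.
  rewrite exchange_big;
    apply: eq_bigr => p _; rewrite linearZ /= sumr mulr_suml.
  by apply: eq_bigr => l _; rewrite mulrA [b _ _ * _]mulrC.
move=> v; rewrite [RHS](coord_vbasis (memvf v)) [LHS](coord_vbasis (memvf _)).
apply: eq_bigr => i _; congr (_ *: _).
have /matrixP/(_ i) := mulmx1C NM => MN.
rewrite linear_sum; under eq_bigr => p _ do rewrite linearZ /= sumr mulr_suml.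
rewrite exchange_big -[RHS]mulr1 /=.
transitivity (\sum_(j < n) coord e j v * (i == j)%:R); last first.
  rewrite (bigD1 i) //= eqxx big1 ?addr0 // => j /negPf ji.
  by rewrite eq_sym ji mulr0.
apply: eq_bigr => j _; have := MN j; rewrite !mxE => <-; rewrite mulr_sumr.
under [RHS]eq_bigr => l _ do rewrite !mxE mulr_suml mulr_sumr.
rewrite exchange_big; apply: eq_bigr => p _ /=.
rewrite -mulrA [b _ _ * _]mulrC suml mulr_sumr mulr_sumr.
by apply: eq_bigr => l _; rewrite !mulrA.
Qed.

(** * The linear form attached to a left integral *)

Section Integrals.
Context {k : fieldType} {H : falgType k} (HH : hopf H).
Local Notation Delta := (comul HH).
Local Notation eps := (counit HH).
Local Notation S := (antipode HH).
Context (L : H) (L0 : L != 0) (intL : left_integral HH L).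

(* With [p L != 0] and dual bases [e_i], [c_i] of [H] and its dual, the form
   [x |-> p L ^-1 * \sum_i (p * c_i) (S (S e_i) * x)] works: the integral
   turns the sum of its values at [L1], times [L2], into
   [p L1 *: (S L2 * L3)]. *)
Lemma integral_form_exists : exists lam : {linear H -> k | *%R},
  \sw_(x, y <- Delta L) (lam x *: y) = 1.
Proof.
have [i pL] : exists i, coord (vbasis {:H}) i L != 0.
  apply/existsP; apply: contraR L0; rewrite negb_exists => /forallP c0.
  rewrite (coord_vbasis (memvf L)) big1 // => i _.
  by move/negbNE/eqP: (c0 i) => ->; rewrite scale0r.
pose n := \dim {:H}; pose e := vbasis {:H}; pose p := coord e i.
pose D (j : 'I_n) (z : H) : k^o :=
  \sw_(u, w <- Delta z) (p u *: (coord e j w : k^o)).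
have linD j : linear (D j) by rewrite /D; lin.
pose form (x : H) : k^o := (p L)^-1 *: \sum_(j < n) D j (S (S e`_j) * x).
have linf : linear form.
  move=> a u v; rewrite /form scalerA mulrC -scalerA -scalerDr; congr (_ *: _).
  rewrite scaler_sumr -big_split; apply: eq_bigr => j _.
  by rewrite mulrDr -scalerAr linD.
pose lam : {linear H -> k | *%R} :=
  HB.pack form (GRing.isLinear.Build k H k *%R form linf).
have [Df DfE] : exists Df : 'I_n -> {linear H -> k | *%R},
    forall j z, Df j z = D j z.
  pose Df j : {linear H -> k | *%R} :=
    HB.pack (D j) (GRing.isLinear.Build k H k *%R (D j) (linD j)).
  by exists Df.
exists lam; rewrite /= /form.
transitivity ((p L)^-1 *: \sum_(j < n)
    \sw_(x, y <- Delta L) (Df j (S (S e`_j) * x) *: y)).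
  rewrite /tsum /tens_eval exchange_big scaler_sumr.
  apply: eq_bigr => q _; rewrite -scalerA scaler_suml.
  by under [in RHS]eq_bigr => j _ do rewrite DfE.
transitivity ((p L)^-1 *: \sw_(x, y <- Delta L) \sw_(u, w <- Delta x)
    (p u *: (S w * y))).
  congr (_ *: _).
  have bD j : bilinear_for *:%R *:%R (fun x y : H => Df j x *: y).
    apply: bilinearI; lin.
  under eq_bigr => j _ do rewrite (sw_integral_shift intL _ (bD j)).
  rewrite /tsum /tens_eval exchange_big; apply: eq_bigr => q _ /=.
  under eq_bigr => j _ do rewrite DfE scaler_suml.
  rewrite exchange_big; apply: eq_bigr => r _ /=.
  rewrite {2}(coord_vbasis (memvf r.2)) linear_sum mulr_suml scaler_sumr.
  by apply: eq_bigr => j _; rewrite linearZ -scalerAl -!scalerA.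
rewrite (sw_coassoc (F := fun u w y => p u *: (S w * y))); last by trilin.
under eq_tsum => u y do rewrite -tsumZ antipodel scalerA mulrC -scalerA.
rewrite (sw_counitr (f := fun u => p u *: 1)); last by lin.
by rewrite scalerA mulVf // scale1r.
Qed.

Context (lam : {linear H -> k | *%R}).
Context (lam1 : \sw_(x, y <- Delta L) (lam x *: y) = 1).

(** The shift moves [h] to the second leg, where it factors out of [lam L1 *: L2 = 1]. Thus
    [Delta L] is a dual tensor for the pairing [lam (S x * y)]. *)
Lemma integral_form_antipode h : \sw_(x, y <- Delta L) (lam (S h * x) *: y) = h.
Proof.
rewrite (sw_integral_shift (F := fun x y => lam x *: y) intL); last first.
  by apply: bilinearI; lin.
rewrite -[RHS]mulr1 -lam1 (tsum_lmap (L := fun z => h * z)); last by lin.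
by apply: eq_tsum => x y; rewrite scalerAr.
Qed.

(** In finite dimension the one-sided duality of [integral_form_antipode] is two-sided. *)
Lemma integral_form_dual h : \sw_(x, y <- Delta L) (lam (S y * h) *: x) = h.
Proof.
apply: (dual_tensor_sym (b := fun v w => lam (S v * w))).
- by move=> v a x y; rewrite mulrDr -scalerAr linearP.
- by move=> v a x y; rewrite linearP mulrDl -scalerAl linearP.
- exact: integral_form_antipode.
Qed.

(** By [integral_form_dual], contracting the second leg of [f L1 \ot L2] against [lam (S _ * h)]
    recovers [f h]. Several identities below are tested this way at [L1]. *)
Lemma integral_ext {V : lmodType k} (f g : H -> V) : linear f -> linear g ->
    \sw_(x, y <- Delta L) (f x \ot y) = \sw_(x, y <- Delta L) (g x \ot y) ->
  f =1 g.
Proof.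
move=> lf lg fg h; pose ev (v : V) y := lam (S y * h) *: v.
have lev : linear (tsum ev).
  by apply: tsum_linearr; apply: bilinearI; rewrite /ev; lin.
have evE (f' : H -> V) : linear f' ->
    tsum ev (\sw_(x, y <- Delta L) (f' x \ot y)) = f' h.
  move=> lf'; rewrite (tsum_lmap _ _ lev) -[in RHS](integral_form_dual h).
  rewrite (tsum_lmap _ _ lf'); apply: eq_tsum => x y.
  rewrite tsum_tens ?linear_funZ //.
  by apply: bilinearI; rewrite /ev; lin.
by rewrite -evE // fg evE.
Qed.

Lemma integral_ext_form (f g : H -> k^o) : linear f -> linear g ->
    \sw_(x, y <- Delta L) (f x *: y) = \sw_(x, y <- Delta L) (g x *: y) ->
  f =1 g.
Proof.
(* [1 \ot _] identifies [H] with [k^o \ox H], which turns sums of scalings into sums of tensors. *)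
have scale1 (f' : H -> k^o) :
    \sw_(x, y <- Delta L) (f' x \ot y) = (1 : k^o) \ot (\sw_(x, y <- Delta L) (f' x *: y)).
  rewrite (tsum_lmap (L := fun z => (1 : k^o) \ot z)); last by lin.
  by apply: eq_tsum => x y; rewrite linearZr -linearZl_LR /= [_ *: 1]mulr1.
by move=> lf lg fg; apply: integral_ext; rewrite // !scale1 fg.
Qed.

Lemma antipode_inj : injective S.
Proof.
by move=> g h Sgh;
  rewrite -[g]integral_form_antipode Sgh integral_form_antipode.
Qed.

Lemma antipode_surj h : exists g, S g = h.
Proof.
have ker0 : lker (linfun S) == 0%VS.
  by apply/lker0P => x y; rewrite !lfunE; apply: antipode_inj.
by exists ((linfun S)^-1%VF h); rewrite -[LHS](lfunE S) lker0_lfunVK.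
Qed.

(** For [z = S w], the coefficients in the expansion of [w] by [integral_form_antipode] are of the
    form [lam (z * u)]. *)
Lemma integral_form_nondeg z : (forall u, lam (z * u) = 0) -> z = 0.
Proof.
have [w <- lam0] := antipode_surj z; rewrite -[w]integral_form_antipode.
rewrite (_ : tsum _ _ = 0) ?linear0 //; apply: big1 => p _.
by rewrite lam0 scale0r.
Qed.

(** By nondegeneracy it suffices to compare [lam (S (x * y) * u)] with [lam (S y * (S x * u))], and
    this only at [u = L1]. Both then expand to [x * y], the second after a shift of [x]. *)
Lemma antipodeM x y : S (x * y) = S y * S x.
Proof.
apply/eqP; rewrite -subr_eq0; apply/eqP/integral_form_nondeg => u.
rewrite mulrBl linearB /= -mulrA; apply/eqP; rewrite subr_eq0; apply/eqP.
apply: (integral_ext_form (f := fun u => lam (S (x * y) * u))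
                          (g := fun u => lam (S y * (S x * u)))).
- by move=> a v w; rewrite mulrDr -scalerAr linearP.
- by move=> a v w; rewrite !(mulrDr, =^~ scalerAr) linearP.
rewrite integral_form_antipode.
rewrite (sw_integral_shift (F := fun u v => lam (S y * u) *: v) intL);
  last first.
  by apply: bilinearI; lin.
rewrite -{1}[y]integral_form_antipode (tsum_lmap (L := fun z => x * z));
  last by lin.
by apply: eq_tsum => v w; rewrite scalerAr.
Qed.

Lemma integral_form_integral : lam L = 1.
Proof.
transitivity (eps (\sw_(x, y <- Delta L) (lam x *: y))); last first.
  by rewrite lam1 rmorph1.
rewrite -{1}(comul1r HH L) /tsum /tens_eval !linear_sum.
by apply: eq_bigr => p _; rewrite !linearZ /= mulrC.
Qed.

(** With [z = S w] the product is [S (w * L)]; so [S] sends a left integral to a right one. *)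
Lemma antipode_integral z : S L * z = eps z *: S L.
Proof.
have [w <-] := antipode_surj z.
by rewrite -antipodeM intL linearZ /= counit_antipode.
Qed.

(** As [S L] is a right integral, the expansion of [L] in [integral_form_antipode] reads
    [L = lam (S L) *: L]. *)
Lemma integral_form_antipode_integral : lam (S L) = 1.
Proof.
have := integral_form_antipode L.
under eq_tsum => x y do rewrite antipode_integral linearZ /= mulrC -scalerA.
rewrite -tsumZ comul1l => /eqP; rewrite -subr_eq0 -{3}[L]scale1r -scalerBl.
by rewrite scaler_eq0 (negPf L0) orbF subr_eq0 => /eqP.
Qed.

(** At [x = L1], both sides tensored with [L2] become [Delta y]. This identity carries the second
    Casimir condition. *)
Lemma integral_form_comul x y :
  \sw_(y1, y2 <- Delta y) (lam (S y2 * x) *: y1) =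
  \sw_(x1, x2 <- Delta x) (lam (S y * x1) *: x2).
Proof.
apply: (integral_ext (f := fun x => \sw_(y1, y2 <- Delta y) (lam (S y2 * x) *: y1))
          (g := fun x => \sw_(x1, x2 <- Delta x) (lam (S y * x1) *: x2))).
- by lin.
- by lin.
transitivity (\sw_(y1, y2 <- Delta y) (y1 \ot y2)).
  under eq_tsum => u v.
    rewrite (tsum_lmap (L := fun z => z \ot v)); last by lin.
    over.
  rewrite exchange_tsum; apply: eq_tsum => y1 y2.
  rewrite -[in RHS](integral_form_antipode y2).
  rewrite (tsum_lmap (L := fun z => y1 \ot z)); last by lin.
  by apply: eq_tsum => u v; rewrite linearZr -linearZl_LR.
pose D z := \sw_(z1, z2 <- Delta z) (z1 \ot z2).
have lD : linear D by rewrite /D; lin.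
under [RHS]eq_tsum => u v.
  rewrite (tsum_lmap (L := fun z => z \ot v)); last by lin.
  over.
rewrite -/(D y) -{1}(integral_form_antipode y) (tsum_lmap _ _ lD).
have := sw_coassoc (HH := HH) (F := fun u v w => lam (S y * u) *: (v \ot w)) L.
under eq_tsum => u v do under eq_tsum => z t do rewrite -linearZl_LR.
move=> ->; last by trilin.
by apply: eq_tsum => u v; rewrite linear_funZ // tsumZ.
Qed.

Context (mu : {lrmorphism H -> k | *%R}) (muL : forall h, L * h = mu h *: L).

(** This computes the Nakayama automorphism [h |-> mu h1 *: S (S h2)] of the form [lam]. At [x = L1]
    both sides expand to [mu h1 *: S h2]. *)
Lemma integral_form_mulr x h :
  lam (x * h) = \sw_(h1, h2 <- Delta h) (mu h1 *: (lam (S (S h2) * x) : k^o)).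
Proof.
apply: (integral_ext_form (f := fun x => lam (x * h)) (g := fun x =>
  \sw_(h1, h2 <- Delta h) (mu h1 *: (lam (S (S h2) * x) : k^o)))).
- by move=> a v w; rewrite mulrDl -scalerAl linearP.
- by lin.
transitivity (\sw_(h1, h2 <- Delta h) (mu h1 *: S h2)); last first.
  rewrite [RHS](_ : _ = \sw_(x, y <- Delta L) \sw_(h1, h2 <- Delta h)
    (mu h1 *: (lam (S (S h2) * x) *: y))); last first.
    apply: eq_tsum => u v; rewrite (tsum_lmap (L := fun c : k^o => c *: v)).
      by apply: eq_tsum => h1 h2; rewrite -scalerA.
    by move=> a c d; rewrite scalerDl scalerA.
  rewrite exchange_tsum; apply: eq_tsum => h1 h2.
  by rewrite -tsumZ integral_form_antipode.
(* Inserting [h2 * S h3] after [L2] makes [Delta (L * h1)] appear, and [L * h1 = mu h1 *: L]. *)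
pose G h1 h2 h3 := \sw_(x, y <- Delta L) (lam (x * h1) *: (y * (h2 * S h3))).
have triG : trilinear G by rewrite /G; trilin.
transitivity (\sw_(h1, h' <- Delta h) \sw_(h2, h3 <- Delta h') G h1 h2 h3).
  rewrite -(sw_counitr (HH := HH)
    (f := fun h => \sw_(x, y <- Delta L) (lam (x * h) *: y))); last by lin.
  apply: eq_tsum => h1 h'; rewrite /G.
  rewrite (sw_antipoder (f := fun z => \sw_(x, y <- Delta L) (lam (x * h1) *: (y * z)))).
    by under [in RHS]eq_tsum => u v do rewrite mulr1.
  by lin.
rewrite -sw_coassoc //; apply: eq_tsum => h' h3; rewrite /G.
under eq_tsum => u v do under eq_tsum => z t do rewrite mulrA.
rewrite exchange_tsum -(sw_comulM (F := fun u v => lam u *: (v * S h3)));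
  last first.
  by apply: bilinearI; lin.
have lE : linear (fun z => \sw_(u, v <- Delta z) (lam u *: (v * S h3))) by lin.
rewrite muL (linear_funZ _ _ lE); congr (_ *: _).
under eq_tsum => u v do rewrite scalerAl.
by rewrite -(tsum_lmap (L := fun z => z * S h3)) ?lam1 ?mul1r //; lin.
Qed.

End Integrals.

(** * The Frobenius system attached to an invertible element *)

Section ComoduleAlgebra.
Context {k : fieldType} {H : falgType k} {HH : hopf H}.
Context {A : algType k} {rho : comodule_algebra HH A}.
Local Notation Delta := (comul HH).
Local Notation eps := (counit HH).
Local Notation S := (antipode HH).

Section Sweedler.
Context {V : lmodType k}.

Lemma sw_coactA (F : A -> H -> H -> V) a : trilinear F ->
  \sw_(a', a2 <- rho a) \sw_(a0, a1 <- rho a') F a0 a1 a2 =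
  \sw_(a0, h <- rho a) \sw_(a1, a2 <- Delta h) F a0 a1 a2.
Proof.
move=> triF; have := congr1 (lift3 F) (coactA rho a).
rewrite !(tsum_lmap _ _ (lift3_linear triF)).
under eq_tsum => x y do rewrite (tsum_lmap _ _ (lift3_linear triF)).
under [RHS]eq_tsum => x y do rewrite (tsum_lmap _ _ (lift3_linear triF)).
under eq_tsum => x y do under eq_tsum => z t do rewrite (lift3_tens triF).
under [RHS]eq_tsum => x y do under eq_tsum => z t do rewrite (lift3_tens triF).
by [].
Qed.

Lemma sw_coact1 (f : A -> V) a : linear f ->
  \sw_(a0, a1 <- rho a) (eps a1 *: f a0) = f a.
Proof.
move=> lf; rewrite -[in RHS](coact1 rho a) (tsum_lmap _ _ lf).
by apply: eq_tsum => x y; rewrite linear_funZ.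
Qed.

Lemma sw_coactM (F : A -> H -> V) a b : bilinear_for *:%R *:%R F ->
  tsum F (rho (a * b)) =
  \sw_(a0, a1 <- rho a) \sw_(b0, b1 <- rho b) F (a0 * b0) (a1 * b1).
Proof. by move=> bF; rewrite rmorphM sw_mul. Qed.

Lemma sw_coact_one (F : A -> H -> V) : bilinear_for *:%R *:%R F ->
  tsum F (rho 1) = F 1 1.
Proof. by move=> bF; rewrite rmorph1 tsum_tens. Qed.

End Sweedler.

(** * The twist of a comodule algebra by a character *)

Section CoactTwist.
Context (chi : {lrmorphism H -> k | *%R}).

Lemma coact_twist_linear : linear (coact_twist rho chi).
Proof. by rewrite /coact_twist; lin. Qed.

Lemma coact_twistM a b :
  coact_twist rho chi (a * b) = coact_twist rho chi a * coact_twist rho chi b.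
Proof.
rewrite /coact_twist (sw_coactM (F := fun a0 a1 => chi a1 *: a0)); last first.
  by apply: bilinearI; lin.
rewrite (tsum_lmap (L := fun z => z * _)); last by lin.
apply: eq_tsum => a0 a1; rewrite (tsum_lmap (L := fun z => _ * z)); last by lin.
by apply: eq_tsum => b0 b1; rewrite rmorphM -scalerAl -scalerAr scalerA.
Qed.

Lemma coact_twist1 : coact_twist rho chi 1 = 1.
Proof.
rewrite /coact_twist sw_coact_one ?rmorph1 ?scale1r //.
by apply: bilinearI; lin.
Qed.

(** [chi \o S] is the convolution inverse of [chi]: the two twists combine into [chi (a1 * S a2)],
    which collapses. This exhibits every element as a twist. *)
Lemma coact_twist_antipode a :
  coact_twist rho chi (coact_twist rho (chi \o S) a) = a.
Proof.
rewrite [coact_twist rho (chi \o S) a]/coact_twist.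
rewrite (tsum_lmap _ _ coact_twist_linear).
under eq_tsum => a0 a1 do
  rewrite (linear_funZ _ _ coact_twist_linear) [coact_twist _ _ _]/coact_twist tsumZ.
rewrite (sw_coactA (F := fun a0 a1 a2 => chi (S a2) *: (chi a1 *: a0)));
  last by trilin.
rewrite -[RHS](sw_coact1 (f := id)) //; apply: eq_tsum => a0 h.
under eq_tsum => h1 h2 do rewrite scalerA mulrC -rmorphM.
rewrite (sw_antipoder (f := fun z => chi z *: a0)); last by lin.
by rewrite rmorph1 scale1r.
Qed.

End CoactTwist.
End ComoduleAlgebra.

Section FrobeniusSystem.
Context {k : fieldType} {H : falgType k} {HH : hopf H}.
Context {A : algType k} {rho : comodule_algebra HH A}.
Local Notation Delta := (comul HH).
Local Notation eps := (counit HH).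
Local Notation S := (antipode HH).
Context (L : H) (L0 : L != 0) (intL : left_integral HH L).
Context (mu : {lrmorphism H -> k | *%R}) (muL : forall h, L * h = mu h *: L).
Context (lam : {linear H -> k | *%R}).
Context (lam1 : \sw_(x, y <- Delta L) (lam x *: y) = 1).
Local Notation sigma := (coact_twist rho mu).
Context (u v : A) (uv : u * v = 1) (vu : v * u = 1).
Context (uE : forall a, a * u = u * sigma a).

Definition casimir_form (x y : H) : A \ox H :=
  \sw_(v0, v1 <- rho v) (lam (S (x * v1) * y) *: (v0 \ot 1)).

Lemma casimir_form_bilinear : bilinear_for *:%R *:%R casimir_form.
Proof. by apply: bilinearI; rewrite /casimir_form; lin. Qed.

Context (B : {linear H \ox H -> A \ox H}).
Context (BE : forall x y, B (x \ot y) = casimir_form x y).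

Lemma twist_inv a : v * a = sigma a * v.
Proof. by rewrite -[v * a]mulr1 -uv mulrA -[v * a * u]mulrA uE mulrA vu mul1r. Qed.

(** [S (g2 * x) * (g3 * y)] contains [S g2 * g3], which collapses. This takes [g] out of [lam] in
    the first Casimir condition. *)
Lemma integral_form_shift {V : lmodType k} x y g (f : H -> V) : linear f ->
  \sw_(g', g3 <- Delta g) \sw_(g1, g2 <- Delta g')
    (lam (S (g2 * x) * (g3 * y)) *: f g1) = lam (S x * y) *: f g.
Proof.
move=> lf.
rewrite (sw_coassoc (F := fun g1 g2 g3 => lam (S (g2 * x) * (g3 * y)) *: f g1));
  last by trilin.
rewrite -(sw_counitr (HH := HH) (f := fun g => lam (S x * y) *: f g));
  last by lin.
apply: eq_tsum => g1 g'.
under eq_tsum => g2 g3 do rewrite (antipodeM intL lam1)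
  mulrA -[S x * _ * g3]mulrA.
rewrite (sw_antipodel (f := fun z => lam (S x * z * y) *: f g1)); last by lin.
by rewrite mulr1.
Qed.

(** Combines [integral_form_mulr] with [S (S h2) * S x = S (x * S h2)]. *)
Lemma integral_form_mulr_antipode {V : lmodType k} x y h (w : V) :
  lam (S x * (y * h)) *: w =
  \sw_(h1, h2 <- Delta h) (mu h1 *: (lam (S (x * S h2) * y) *: w)).
Proof.
rewrite mulrA (integral_form_mulr intL lam1 muL).
rewrite (tsum_lmap (L := fun c : k^o => c *: w)); last first.
  by move=> a c d; rewrite scalerDl scalerA.
by apply: eq_tsum => h1 h2; rewrite -scalerA (antipodeM intL lam1) mulrA.
Qed.

Lemma casimir_form_casimir : casimir rho B.
Proof.
split=> [a g h h'|h h'].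
(* The left side once [g] has been taken out of [lam]; [z] is the second leg. *)
- pose Q (z : H) := \sw_(a', a2 <- rho a) \sw_(a0, a1 <- rho a') \sw_(v0, v1 <- rho v)
    (lam (S (h * a1 * v1) * (h' * a2)) *: ((a0 * v0) \ot z)).
  have lQ : linear Q by rewrite /Q; lin.
  transitivity (Q g).
    pose T (g1 g2 g3 : H) := \sw_(a', a2 <- rho a) \sw_(a0, a1 <- rho a')
      \sw_(v0, v1 <- rho v)
      (lam (S (g2 * (h * a1 * v1)) * (g3 * (h' * a2))) *: ((a0 * v0) \ot g1)).
    transitivity (\sw_(g', g3 <- Delta g) \sw_(g1, g2 <- Delta g') T g1 g2 g3).
      apply: eq_tsum => g' g3; apply: eq_tsum => g1 g2.
      apply: eq_tsum => a' a2; apply: eq_tsum => a0 a1.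
      rewrite BE /casimir_form.
      rewrite (tsum_lmap (L := fun z => (a0 \ot 1) * z)); last by lin.
      rewrite (tsum_lmap (L := fun z => z * (1 \ot g1))); last by lin.
      apply: eq_tsum => v0 v1.
      by rewrite -scalerAr -scalerAl !tensM !mulr1 mul1r !mulrA.
    rewrite /T /Q.
    under eq_tsum => g' g3 do rewrite exchange_tsum.
    rewrite exchange_tsum; apply: eq_tsum => a' a2.
    under eq_tsum => g' g3 do rewrite exchange_tsum.
    rewrite exchange_tsum; apply: eq_tsum => a0 a1.
    under eq_tsum => g' g3 do rewrite exchange_tsum.
    rewrite exchange_tsum; apply: eq_tsum => v0 v1.
    by rewrite (integral_form_shift _ _ _ (f := fun z => (a0 * v0) \ot z));
      last by lin.
  (* The rightmost [a2] is carried across [lam]: it splits into [mu b1] and a factor [S b2] inside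
     the antipode, which is the [S z] of [R]. *)
  pose R (z : H) (c : A) (d : H) := lam (S (h * (d * S z)) * h') *: (c \ot g).
  have bR z : bilinear_for *:%R *:%R (R z) by apply: bilinearI; rewrite /R; lin.
  transitivity (\sw_(a', a2 <- rho a) \sw_(b1, b2 <- Delta a2)
      (mu b1 *: tsum (R b2) (rho (a' * v)))).
    apply: eq_tsum => a' a2.
    under [RHS]eq_tsum => b1 b2 do rewrite sw_coactM // tsumZ.
    rewrite [RHS]exchange_tsum; apply: eq_tsum => a0 a1.
    under [RHS]eq_tsum => b1 b2 do rewrite tsumZ.
    rewrite [RHS]exchange_tsum; apply: eq_tsum => v0 v1.
    rewrite integral_form_mulr_antipode; apply: eq_tsum => b1 b2.
    by rewrite /R !mulrA.
  rewrite -(sw_coactA (F := fun a' b1 b2 => mu b1 *: tsum (R b2) (rho (a' * v))));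
    last by rewrite /R; trilin.
  (* [mu b1] now twists [a'], and [sigma a' * v = v * a']. With [v] on the left, [a1 * S b2] can
     collapse, which leaves [a] on the right. *)
  transitivity (\sw_(a', b2 <- rho a) tsum (R b2) (rho (v * a'))).
    apply: eq_tsum => a' b2.
    have lT : linear (fun c => tsum (R b2) (rho (c * v))) by rewrite /R; lin.
    rewrite twist_inv /coact_twist (tsum_lmap _ _ lT).
    by apply: eq_tsum => a0 b1; rewrite (linear_funZ _ _ lT).
  under eq_tsum => a' b2 do rewrite sw_coactM // exchange_tsum.
  under eq_tsum => a' b2 do rewrite exchange_tsum.
  rewrite exchange_tsum BE /casimir_form.
  rewrite (tsum_lmap (L := fun z => (1 \ot g) * z)); last by lin.
  rewrite (tsum_lmap (L := fun z => z * (a \ot 1))); last by lin.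
  apply: eq_tsum => v0 v1.
  rewrite -scalerAr -scalerAl !tensM !mulr1 mul1r.
  rewrite (sw_coactA (F := fun a0 a1 b2 => R b2 (v0 * a0) (v1 * a1)));
    last by rewrite /R; trilin.
  rewrite -(sw_coact1 (rho := rho)
    (f := fun c => lam (S (h * v1) * h') *: ((v0 * c) \ot g))); last by lin.
  apply: eq_tsum => a0 x; rewrite /R.
  under eq_tsum => a1 b2 do rewrite -mulrA.
  rewrite (sw_antipoder (f := fun z =>
    lam (S (h * (v1 * z)) * h') *: ((v0 * a0) \ot g))); last by lin.
  by rewrite mulr1.
(* [B] takes its values in [A \ot 1], so [cowreath_psi] is evaluated at [l = 1], where it reduces to
   the coaction. *)
- have psi1 h1 b : cowreath_psi rho h1 b 1 =
      \sw_(b0, b1 <- rho b) (b0 \ot (1 : H) \ot (h1 * b1)).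
    rewrite /cowreath_psi; apply: eq_tsum => b0 b1.
    rewrite (sw_comul1 (F := fun l1 l2 => b0 \ot l1 \ot (l2 * h1 * b1))) ?mul1r //.
    by apply: bilinearI; lin.
  have bpsi h1 : bilinear_for *:%R *:%R (cowreath_psi rho h1).
    by apply: bilinearI; rewrite /cowreath_psi; lin.
  transitivity (\sw_(h1, h2 <- Delta h) \sw_(v', x2 <- rho v) \sw_(v0, x1 <- rho v')
      (lam (S (h2 * x2) * h') *: (v0 \ot (1 : H) \ot (h1 * x1)))).
    apply: eq_tsum => h1 h2; rewrite BE /casimir_form.
    rewrite (tsum_lmap _ _ (tsum_linearr (bpsi h1))); apply: eq_tsum => v' x2.
    by rewrite (linear_funZ _ _ (tsum_linearr (bpsi h1))) tsum_tens // psi1 tsumZ.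
  rewrite exchange_tsum.
  under eq_tsum => v' x2 do rewrite exchange_tsum.
  rewrite (sw_coactA (F := fun v0 x1 x2 => \sw_(h1, h2 <- Delta h)
    (lam (S (h2 * x2) * h') *: (v0 \ot (1 : H) \ot (h1 * x1)))));
      last by trilin.
  under [RHS]eq_tsum => h'1 h'2.
    rewrite BE /casimir_form (tsum_lmap (L := fun z => z \ot h'2)); last by lin.
    over.
  rewrite [RHS]exchange_tsum; apply: eq_tsum => v0 x.
  (* [h1 * x1] and [h2 * x2] are the legs of [Delta (h * x)], so the claim becomes
     [integral_form_comul] at [y = h * x]. *)
  rewrite exchange_tsum -(sw_comulM (F := fun y1 y2 =>
    lam (S y2 * h') *: (v0 \ot (1 : H) \ot y1))); last by apply: bilinearI; lin.
  under [RHS]eq_tsum => h'1 h'2 do rewrite linearZl_LR.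
  have := congr1 (fun z => v0 \ot (1 : H) \ot z) (integral_form_comul intL lam1 h' (h * x)).
  rewrite !(tsum_lmap (L := fun z => v0 \ot (1 : H) \ot z)); [|by lin|by lin].
  by under eq_tsum => y1 y2 do rewrite linearZr;
    under [RHS]eq_tsum => y1 y2 do rewrite linearZr.
Qed.

Let t : A \ox H \ox H := u \ot 1 \ot L.

(** [h2 * L * a1] is [L] scaled by [eps h2] and [mu a1], so the right side becomes
    [(u * sigma a) \ot h \ot L]. *)
Lemma integral_frobenius_element : frobenius_element rho t.
Proof.
move=> a h.
rewrite -[LHS]/(lift3 (fun t1 t2 t3 => (a * t1) \ot (t2 * h) \ot t3) t).
rewrite -[RHS]/(lift3 (fun t1 t2 t3 => \sw_(a0, a1 <- rho a) \sw_(h1, h2 <- Delta h)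
   ((t1 * a0) \ot (h1 * t2) \ot (h2 * t3 * a1))) t).
rewrite !lift3_tens; [|by trilin|by trilin].
rewrite uE mul1r /coact_twist (tsum_lmap (L := fun z => (u * z) \ot h \ot L));
  last by lin.
apply: eq_tsum => a0 a1.
rewrite -(sw_counitr (HH := HH)
  (f := fun h => (u * (mu a1 *: a0)) \ot h \ot L)); last by lin.
apply: eq_tsum => h1 h2.
by rewrite intL mulr1 -scalerAl muL !linearZr -scalerAr !linearZl_LR.
Qed.

(** [uE] at [v] gives [u * sigma v = 1]. *)
Lemma twist_fixed_inv : sigma v = v.
Proof. by rewrite -[LHS]mul1r -vu -mulrA -uE vu mulr1. Qed.

Lemma integral_frobenius_counit : frobenius_counit rho B t.
Proof.
have lB z : linear (fun x => B (x \ot z)) by lin.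
move=> h; split.
- rewrite -[LHS]/(lift3 (fun t1 t2 t3 => (t1 \ot 1) * B (t3 \ot h) * (1 \ot t2)) t).
  rewrite lift3_tens; last by trilin.
  rewrite BE /casimir_form -[(1 : A) \ot 1]/(1 : A \ox H) mulr1.
  have -> : \sw_(v0, v1 <- rho v) (lam (S (L * v1) * h) *: (v0 \ot 1)) =
      eps h *: (v \ot (1 : H)).
    (* [S (L * v1) * h] is [S L] scaled by [mu v1] and [eps h], and [lam (S L) = 1]; the scalars
       [mu v1] build [sigma v = v]. *)
    rewrite -{2}twist_fixed_inv /coact_twist.
    rewrite (tsum_lmap (L := fun z => eps h *: (z \ot (1 : H)))); last by lin.
    apply: eq_tsum => v0 v1; rewrite muL linearZ /= -scalerAl.
    rewrite (antipode_integral intL lam1) !linearZ /=.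
    by rewrite (integral_form_antipode_integral L0 intL lam1) mulr1
      linearZl_LR scalerA mulrC.
  by rewrite -scalerAr tensM uv mulr1.
- rewrite -[RHS]/(lift3 (fun t1 t2 t3 => \sw_(t10, t11 <- rho t1)
    \sw_(t21, t22 <- Delta t2)
        ((t10 \ot 1) * B ((t22 * h * t11) \ot t3) * (1 \ot t21))) t).
  rewrite lift3_tens; last by trilin.
  rewrite -{1}uv -(sw_coact1 (rho := rho) (f := fun z => eps h *: ((z * v) \ot (1 : H))));
    last by lin.
  apply: eq_tsum => u0 u1.
  rewrite (sw_comul1 (F := fun t21 t22 =>
    (u0 \ot 1) * B ((t22 * h * u1) \ot L) * (1 \ot t21)));
      last by apply: bilinearI; lin.
  rewrite mul1r -[(1 : A) \ot 1]/(1 : A \ox H) mulr1 BE /casimir_form.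
  (* Here [L] absorbs from the left: [S (h * u1 * v1) * L = eps (h * u1 * v1) *: L], and
     [lam L = 1]. *)
  have -> : \sw_(v0, v1 <- rho v) (lam (S (h * u1 * v1) * L) *: (v0 \ot 1)) =
      eps (h * u1) *: (v \ot (1 : H)).
    rewrite -(sw_coact1 (rho := rho) (f := fun z => eps (h * u1) *: (z \ot (1 : H))));
      last by lin.
    apply: eq_tsum => v0 v1.
    rewrite intL counit_antipode linearZ /= (integral_form_integral lam1) mulr1.
    by rewrite [eps (h * u1 * v1)]rmorphM scalerA mulrC.
  by rewrite -scalerAr tensM mulr1 rmorphM scalerA mulrC.
Qed.

End FrobeniusSystem.

(** * The invertible element attached to a Frobenius system *)

Section FrobeniusInvertible.
Context {k : fieldType} {H : falgType k} {HH : hopf H}.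
Context {A : algType k} {rho : comodule_algebra HH A}.
Local Notation Delta := (comul HH).
Local Notation eps := (counit HH).
Local Notation S := (antipode HH).
Context (L : H) (L0 : L != 0) (intL : left_integral HH L).
Context (mu : {lrmorphism H -> k | *%R}) (muL : forall h, L * h = mu h *: L).
Context (lam : {linear H -> k | *%R}).
Context (lam1 : \sw_(x, y <- Delta L) (lam x *: y) = 1).
Local Notation sigma := (coact_twist rho mu).

Lemma tsum_pure (x : A \ox H) : \sw_(a, h <- x) (a \ot h) = x.
Proof. by rewrite [RHS](tens_sum x). Qed.

(** * The integral inside a Frobenius element *)

Section Element.
Context (t : A \ox H \ox H) (tF : frobenius_element rho t).

Definition antipode_contract (s : A \ox H \ox H) : A \ox H :=
  lift3 (fun t1 t2 t3 => t1 \ot (S t2 * t3)) s.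

Local Notation r := (antipode_contract t).

(** The contraction is applied to the condition on [t]. On one side [S (t2 * h) = S h * S t2]; on
    the other, [S (h1 * t2) * h2] contains [S h1 * h2], which collapses to [eps h]. *)
Lemma antipode_contract_comm a h :
  (a \ot S h) * r = eps h *: (r * rho a).
Proof.
have triP : trilinear (fun (t1 : A) t2 t3 => t1 \ot (S t2 * t3)) by trilin.
have linP := lift3_linear triP.
have := congr1 antipode_contract (tF a h); rewrite /antipode_contract.
rewrite !(tsum_lmap _ _ linP).
under eq_tsum => t' t3 do rewrite (tsum_lmap _ _ linP).
under [X in _ = X]eq_tsum => t' t3 do rewrite (tsum_lmap _ _ linP).
under eq_tsum => t' t3 do under eq_tsum => t1 t2 do
  rewrite (lift3_tens triP) (antipodeM intL lam1) -mulrA -tensM.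
move=> E; rewrite /lift3 (tsum_lmap (L := fun z => (a \ot S h) * z));
  last by lin.
under eq_tsum => t' t3 do
  rewrite (tsum_lmap _ _ (linear_mulr (a \ot S h) (@linear_id _ _))).
rewrite {}E (tsum_lmap (L := fun z => eps h *: (z * rho a))); last by lin.
apply: eq_tsum => t' t3.
rewrite (tsum_lmap (L := fun z => eps h *: (z * rho a))); last by lin.
apply: eq_tsum => t1 t2.
rewrite -{2}(tsum_pure (rho a)) (tsum_lmap _ _ linP).
rewrite (tsum_lmap (L := fun z => eps h *: (t1 \ot (S t2 * t3) * z)));
  last by lin.
apply: eq_tsum => a0 a1; rewrite (tsum_lmap _ _ linP).
under eq_tsum => h1 h2 do rewrite (lift3_tens triP) (antipodeM intL lam1).
rewrite tensM.
have := sw_antipodel (HH := HH)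
  (f := fun z => (t1 * a0) \ot (S t2 * (z * (t3 * a1)))) h.
rewrite mul1r mulrA => <-; last by lin.
by apply: eq_tsum => h1 h2; rewrite !mulrA.
Qed.

Lemma antipode_contract_integral : exists u : A, r = u \ot L.
Proof.
have rL h : (1 \ot S h) * r = eps h *: r.
  by rewrite antipode_contract_comm rmorph1 mulr1.
(* As [lam L = 1], applying [lam] to the second leg of [u \ot L] returns [u]. *)
exists (\sw_(a, h <- r) (lam h *: a)).
pose F (y : A \ox H) (x : H) := \sw_(a, h <- y) ((lam h *: a) \ot x).
have lF x : linear (fun y => F y x) by rewrite /F; lin.
(* Each second leg [h] of [r] is expanded as [lam (S L2 * h) *: L1]. By [rL], [S L2] acts on [r] as
   [eps L2], so the factors [L1] add up to [L]. *)
transitivity (\sw_(x, y <- Delta L) F ((1 \ot S y) * r) x).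
  rewrite -{1}(tsum_pure r).
  under [RHS]eq_tsum => x y.
    rewrite -{1}(tsum_pure r) (tsum_lmap (L := fun z => F ((1 \ot S y) * z) x));
      last first.
      by apply: linear_comp_lin (lF x) _; lin.
    over.
  rewrite exchange_tsum; apply: eq_tsum => a h.
  rewrite -{1}(integral_form_dual intL lam1 h).
  rewrite (tsum_lmap (L := fun z => a \ot z)); last by lin.
  apply: eq_tsum => x y; rewrite tensM mul1r /F tsum_tens.
    by rewrite linearZr linearZl_LR.
  by apply: bilinearI; lin.
under eq_tsum => x y do rewrite rL (linear_funZ _ _ (lF x)).
rewrite (sw_counitr (f := F r)); last by rewrite /F; lin.
by rewrite (tsum_lmap (L := fun z => z \ot L)); last by lin.
Qed.

Lemma tens_integral_inj (a b : A) : a \ot L = b \ot L -> a = b.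
Proof.
pose f (a : A) h := lam h *: a.
have fE c : tsum f (c \ot L) = c.
  rewrite tsum_tens; first by rewrite /f (integral_form_integral lam1) scale1r.
  by apply: bilinearI; rewrite /f; lin.
by move=> e; rewrite -[a]fE e fE.
Qed.

(** At [h = 1] the commutation rule reads [(a * u) \ot L = (u * a0) \ot (L * a1)], and
    [L * a1 = mu a1 *: L]. *)
Lemma antipode_contract_twist u : r = u \ot L -> forall a, a * u = u * sigma a.
Proof.
move=> ru a; apply: tens_integral_inj; have := antipode_contract_comm a 1.
rewrite antipode1 rmorph1 scale1r ru tensM mul1r => ->.
rewrite -(tsum_pure (rho a)) (tsum_lmap (L := fun z => (u \ot L) * z));
  last by lin.
rewrite /coact_twist (tsum_lmap (L := fun z => (u * z) \ot L)); last by lin.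
apply: eq_tsum => a0 a1.
by rewrite tensM muL linearZr -scalerAr linearZl_LR.
Qed.

End Element.

(** * Casimir morphisms with the counit applied to the second leg *)

Definition slice (x : A \ox H) : A := \sw_(a, h <- x) (eps h *: a).

Lemma slice_linear : linear slice.
Proof. by rewrite /slice; lin. Qed.

Lemma slice_tens a h : slice (a \ot h) = eps h *: a.
Proof. by rewrite /slice tsum_tens //; apply: bilinearI; lin. Qed.

HB.instance Definition _ :=
  GRing.isLinear.Build k (A \ox H)%type A *:%R slice slice_linear.

(** [eps] is multiplicative, so [slice] is an algebra map and passes through the products in the
    Casimir and counit conditions. *)
Lemma sliceM x y : slice (x * y) = slice x * slice y.
Proof.
rewrite -{1}(tsum_pure x) (tsum_lmap (L := fun z => slice (z * y)));
  last by lin.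
rewrite {2}/slice (tsum_lmap (L := fun z => z * slice y)); last by lin.
apply: eq_tsum => a h.
rewrite -{1}(tsum_pure y) (tsum_lmap (L := fun z => slice ((a \ot h) * z)));
  last by lin.
rewrite {2}/slice (tsum_lmap (L := fun z => (eps h *: a) * z)); last by lin.
apply: eq_tsum => b g.
by rewrite tensM slice_tens rmorphM -scalerAr -scalerAl scalerA mulrC.
Qed.

Context (B : {linear H \ox H -> A \ox H}) (CB : casimir rho B).

Local Notation f x y := (slice (B (x \ot y))).

(** [slice] sends [1 \ot g1] to [eps g1], so the threefold sum over [g] in the first Casimir
    condition drops to a twofold one. *)
Lemma casimir_slice a g h h' :
  \sw_(g1, g2 <- Delta g) \sw_(a', a2 <- rho a) \sw_(a0, a1 <- rho a')
    (a0 * f (g1 * h * a1) (g2 * h' * a2)) = eps g *: (f h h' * a).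
Proof.
have := congr1 slice (CB.1 a g h h').
rewrite !sliceM !slice_tens rmorph1 scale1r -!scalerAl mul1r => <-.
rewrite -(sw_counitl (HH := HH) (f := fun g => \sw_(g1, g2 <- Delta g)
  \sw_(a', a2 <- rho a) \sw_(a0, a1 <- rho a')
    (a0 * f (g1 * h * a1) (g2 * h' * a2)))); last by lin.
under eq_tsum => g1 g' do rewrite tsumZ.
rewrite -(sw_coassoc (F := fun g1 g2 g3 => eps g1 *: \sw_(a', a2 <- rho a)
  \sw_(a0, a1 <- rho a') (a0 * f (g2 * h * a1) (g3 * h' * a2))));
    last by trilin.
rewrite [RHS](tsum_lmap _ _ slice_linear);
  apply: eq_tsum => g' g3; rewrite [RHS](tsum_lmap _ _ slice_linear).
apply: eq_tsum => g1 g2; rewrite [RHS](tsum_lmap _ _ slice_linear) tsumZ.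
apply: eq_tsum => a' a2; rewrite [RHS](tsum_lmap _ _ slice_linear) tsumZ.
apply: eq_tsum => a0 a1.
by rewrite !sliceM !slice_tens rmorph1 scale1r -scalerAr mulr1.
Qed.

Lemma casimir_slice_invariant g h h' :
  \sw_(g1, g2 <- Delta g) f (g1 * h) (g2 * h') = eps g *: f h h'.
Proof.
have := casimir_slice 1 g h h'; rewrite mulr1 => <-.
apply: eq_tsum => g1 g2.
rewrite sw_coact_one; last by apply: bilinearI; lin.
rewrite sw_coact_one; last by apply: bilinearI; lin.
by rewrite !mulr1 mul1r.
Qed.

Lemma casimir_slice_comm a h h' :
  \sw_(a', a2 <- rho a) \sw_(a0, a1 <- rho a') (a0 * f (h * a1) (h' * a2)) =
  f h h' * a.
Proof.
have := casimir_slice a 1 h h'; rewrite [eps 1]rmorph1 scale1r => <-.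
rewrite sw_comul1; last by apply: bilinearI; lin.
by under [RHS]eq_tsum => a' a2 do
  (under eq_tsum => a0 a1 do rewrite !mul1r).
Qed.

(** Rewrite [z] as [x2 * (S x3 * z)]; invariance then removes [x1] and [x2]. *)
Lemma casimir_slice_antipode x y z : f (x * y) z = f y (S x * z).
Proof.
rewrite -[LHS](sw_counitr (HH := HH) (f := fun x => f (x * y) z) x);
  last by lin.
transitivity (\sw_(x1, x' <- Delta x) \sw_(x2, x3 <- Delta x')
    f (x1 * y) (x2 * (S x3 * z))).
  apply: eq_tsum => x1 x'.
  under eq_tsum => x2 x3 do rewrite mulrA.
  rewrite (sw_antipoder (f := fun w => f (x1 * y) (w * z))); last by lin.
  by rewrite mul1r.
rewrite -(sw_coassoc (F := fun x1 x2 x3 => f (x1 * y) (x2 * (S x3 * z))));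
  last by trilin.
under eq_tsum => x' x3 do rewrite casimir_slice_invariant.
by rewrite (sw_counitl (f := fun x => f y (S x * z))); last by lin.
Qed.

Context (t : A \ox H \ox H) (tF : frobenius_element rho t).
Context (tB : frobenius_counit rho B t).
Context (u : A) (ru : antipode_contract t = u \ot L).
Local Notation theta := (fun a => \sw_(a0, a1 <- rho a) (a0 * f a1 L)).

(** This is [casimir_slice_comm] at [h = 1] and [h' = L], where [L * a2 = mu a2 *: L] supplies the
    twist. *)
Lemma casimir_slice_twist a : theta (sigma a) = f 1 L * a.
Proof.
have lT : linear theta by lin.
rewrite -casimir_slice_comm /coact_twist (tsum_lmap _ _ lT).
apply: eq_tsum => a' a2; rewrite (linear_funZ _ _ lT) tsumZ;
  apply: eq_tsum => a0 a1.
by rewrite mul1r muL linearZr linearZ (linear_funZ _ _ slice_linear) scalerAr.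
Qed.

(** In the [slice] of the second counit identity at [1], [casimir_slice_antipode] moves [t2] over to
    [t3], so the sum depends on [t] only through [antipode_contract t = u \ot L]. *)
Lemma frobenius_counit_slice : theta u = 1.
Proof.
pose W (x : A \ox H) :=
  \sw_(a, h <- x) \sw_(a0, a1 <- rho a) (a0 * f a1 h).
have bW : bilinear_for *:%R *:%R (fun a h => \sw_(a0, a1 <- rho a) (a0 * f a1 h)).
  by apply: bilinearI; lin.
have lW : linear W := tsum_linearr bW.
have -> : \sw_(a0, a1 <- rho u) (a0 * f a1 L) = W (antipode_contract t).
  by rewrite ru /W tsum_tens.
have := congr1 slice (tB 1).2.
rewrite rmorph1 scale1r slice_tens rmorph1 scale1r => ->.
rewrite /antipode_contract /lift3 (tsum_lmap _ _ lW)
  (tsum_lmap _ _ slice_linear).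
apply: eq_tsum => t' t3;
  rewrite (tsum_lmap _ _ lW) (tsum_lmap _ _ slice_linear).
apply: eq_tsum => t1 t2; rewrite /W tsum_tens // (tsum_lmap _ _ slice_linear).
apply: eq_tsum => a0 a1;
  rewrite -casimir_slice_antipode (tsum_lmap _ _ slice_linear).
under eq_tsum => t21 t22 do
  rewrite !sliceM !slice_tens rmorph1 scale1r mulr1 -scalerAr mulr1.
by rewrite (sw_counitl (f := fun z => a0 * f (z * a1) t3)); last by lin.
Qed.

(* [y * u = 1] for [y := sigma (f 1 L)], while [uE] at [y] gives
   [y * u = u * sigma y]. *)
Lemma frobenius_invertible : invertible u.
Proof.
have uE := antipode_contract_twist tF ru.
pose y := sigma (f 1 L).
have yu : y * u = 1.
  (* [u = sigma u'] with [u'] the twist of [u] by [mu \o S]; hence [y * u = sigma (f 1 L * u') =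
     sigma (theta u) = sigma 1]. *)
  rewrite /y -{1}(coact_twist_antipode (rho := rho) mu u) -coact_twistM.
  by rewrite -casimir_slice_twist coact_twist_antipode
    frobenius_counit_slice coact_twist1.
have uy : u * sigma y = 1 by rewrite -uE.
exists y; split=> //.
have ey : y = sigma y by rewrite -[LHS]mulr1 -uy mulrA yu mul1r.
by rewrite ey.
Qed.

End FrobeniusInvertible.

(** For [v] inverse to [u], [a * u = u * sigma a] amounts to [sigma a = v * a * u]: the twist is
    conjugation by the inverse of [u]. *)
Lemma innerP {k : fieldType} {H : falgType k} {HH : hopf H}
    {mu : {lrmorphism H -> k | *%R}} {A : algType k} {rho : comodule_algebra HH A} :
  inner (coact_twist rho mu) <-> exists u : A, invertible u /\
    forall a : A, a * u = \sw_(a0, a1 <- rho a) (mu a1 *: (u * a0)).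
Proof.
have mulE u a : \sw_(a0, a1 <- rho a) (mu a1 *: (u * a0)) = u * coact_twist rho mu a.
  rewrite /coact_twist (tsum_lmap (L := fun z => u * z)); last by lin.
  by apply: eq_tsum => a0 a1; rewrite scalerAr.
split=> [[v [u [vu uv sE]]]|[u [[v [uv vu]] uE]]].
- exists u; split; first by exists v.
  by move=> a; rewrite mulE sE !mulrA uv mul1r.
- by exists v, u; split=> // a; rewrite -mulrA uE mulE mulrA vu mul1r.
Qed.

Theorem theorem3p14 (k : fieldType) (H : falgType k) (HH : hopf H)
    (mu : {lrmorphism H -> k | *%R}) (hmu : distinguished_grouplike HH mu)
    (A : algType k) (rho : comodule_algebra HH A) :
  (frobenius_cowreath rho <->
     exists u : A, invertible u /\
       forall a : A, a * u = \sw_(a0, a1 <- rho a) (mu a1 *: (u * a0)))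
  /\
  (frobenius_cowreath rho <-> inner (coact_twist rho mu)).
Proof.
suff frobP : frobenius_cowreath rho <-> inner (coact_twist rho mu).
  by split=> //; rewrite frobP; exact: innerP.
case: hmu => L [L0 intL muL].
have [lam lam1] := integral_form_exists L0 intL.
split=> [[B [t [CB tF tB]]]|[v [u [vu uv sE]]]].
- have [u ru] := antipode_contract_integral intL lam1 tF.
  have [v [uv vu]] := frobenius_invertible intL muL lam1 CB tF tB ru.
  exists v, u; split=> // a.
  by rewrite -mulrA (antipode_contract_twist intL muL lam1 tF ru) mulrA vu mul1r.
- have uE a : a * u = u * coact_twist rho mu a by rewrite sE !mulrA uv mul1r.
  (* [casimir_form] is bundled as a bilinear map so that [lift_tens] extends it to [H \ox H]. *)
  pose b : {bilinear H -> H -> A \ox H} := HB.pack (casimir_form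
    (rho := rho) lam v)
    (bilinear_isBilinear.Build k H H (A \ox H)%type *:%R *:%R _
      (casimir_form_bilinear (rho := rho) lam v)).
  exists (lift_tens b), (u \ot 1 \ot L).
  have bE x y : lift_tens b (x \ot y) = casimir_form (rho := rho) lam v x y.
    exact: tsum_tens (casimir_form_bilinear _ _).
  split.
  + exact: (casimir_form_casimir intL muL lam1 uv vu uE bE).
  + exact: (integral_frobenius_element intL muL uE).
  + exact: (integral_frobenius_counit L0 intL muL lam1 uv vu uE bE).
Qed.
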